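(* Let $0<q<1$, let $\{\omega_n(z;q)\}_{n\in\mathbb N_0}$ be an even $q$-Lidstone polynomial sequence of type I with matrix $F_q$, and let $G_q$ be the matrix built from the associated sequence $(\xi_{2n})_n$, as in the context. Let $\{\hat\omega_n(z;q)\}_{n\in\mathbb N_0}$ be a sequence of polynomials. Put $\Omega_q=[\omega_0,\omega_1,\dots]^T$, $\widehat\Omega_q=[\hat\omega_0,\hat\omega_1,\dots]^T$, $\Omega_{q,n}=[\omega_0,\dots,\omega_n]^T$, $\widehat\Omega_{q,n}=[\hat\omega_0,\dots,\hat\omega_n]^T$. Then $\{\omega_n(z;q)\}_n$ and $\{\hat\omega_n(z;q)\}_n$ are conjugate even $q$-Lidstone-type I sequences if and only if $$\Omega_q=F_q^2\,\widehat\Omega_q,\qquad \widehat\Omega_q=G_q^2\,\Omega_q,$$ and, for $n\in\mathbb N$, $$\Omega_{q,n}=F_{q,n}^2\,\widehat\Omega_{q,n},\qquad \widehat\Omega_{q,n}=G_{q,n}^2\,\Omega_{q,n}.$$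
   Context: Fix $0<q<1$. Put $[m]_q=\frac{1-q^m}{1-q}$, $[m]_q!=\prod_{j=1}^m[j]_q$, $[0]_q!=1$, and ${n \brack k}_q=\frac{[n]_q!}{[k]_q!\,[n-k]_q!}$ for $0\le k\le n$. $\mathbb N=\{1,2,\dots\}$, $\mathbb N_0=\mathbb N\cup\{0\}$. The Jackson $q$-derivative is $D_qf(z)=\frac{f(qz)-f(z)}{(q-1)z}$ for $z\ne0$ and $D_qf(0)=f'(0)$, so $D_qz^m=[m]_qz^{m-1}$. An even $q$-Lidstone polynomial sequence of type I (class $q$ELS-I) is a sequence $\{\omega_n(z;q)\}_{n\in\mathbb N_0}$ of polynomials in $z$ with real coefficients such that $D_q^2\omega_n(z;q)=[2n]_q[2n-1]_q\,\omega_{n-1}(z;q)$ for $n\in\mathbb N$, $D_q\omega_n(0;q)=0$ for $n\in\mathbb N_0$, and $\omega_0(z;q)=\gamma_0$ with $\gamma_0\in\mathbb R\setminus\{0\}$. Its associated numerical sequence is $\gamma_{2n}:=\omega_n(0;q)$, and $\omega_n(z;q)=\sum_{k=0}^n{2n \brack 2k}_q\gamma_{2(n-k)}z^{2k}$. The sequence $(\xi_{2n})_{n\ge0}$ is the unique real sequence with $\sum_{j=0}^n\frac{\gamma_{2j}\,\xi_{2(n-j)}}{[2j]_q!\,[2(n-j)]_q!}=\delta_{n0}$ for all $n\in\mathbb N_0$. $F_q=[f_{ij}]_{i,j\in\mathbb N_0}$ and $G_q=[g_{ij}]_{i,j\in\mathbb N_0}$ are the infinite lower triangular matrices with $f_{ij}={2i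 \brack 2j}_q\gamma_{2(i-j)}$ and $g_{ij}={2i \brack 2j}_q\xi_{2(i-j)}$ for $i\ge j$ (and $0$ for $i<j$); $F_{q,n},G_{q,n}$ are their leading principal submatrices with indices $0\le i,j\le n$. Products of infinite lower triangular matrices (with each other or with column vectors) are well defined by finite sums. The sequence $\{\hat\omega_n\}_n$ is said to be conjugate to $\{\omega_n\}_n$ (the two are conjugate even $q$-Lidstone-type I sequences) if $\hat\omega_n(z;q)=\sum_{k=0}^n{2n \brack 2k}_q\xi_{2(n-k)}z^{2k}$ for all $n\in\mathbb N_0$. *)

(* Defs.v *)
From mathcomp Require Import all_boot all_order all_algebra.
From mathcomp Require Import all_classical all_reals all_analysis.
From mathcomp Require Import ring.
Set Implicit Arguments.
Unset Strict Implicit.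
Unset Printing Implicit Defensive.
Import Order.TTheory GRing.Theory Num.Theory.
Import numFieldNormedType.Exports.
Local Open Scope ring_scope.

Section qLidstone.
Variable R : realType.
Implicit Types (q : R) (g xi : nat -> R) (w : nat -> {poly R}).

Definition qnum q (m : nat) : R := (1 - q ^+ m) / (1 - q).

Definition qfact q (m : nat) : R := \prod_(1 <= j < m.+1) qnum q j.

(* Only meaningful for k <= n, because of the truncated subtraction. *)
Definition qbin q (n k : nat) : R := qfact q n / (qfact q k * qfact q (n - k)).

Definition Dq q (f : R -> R) (z : R) : R :=
  if z == 0 then (f^`())%classic 0 else (f (q * z) - f z) / ((q - 1) * z).

Definition is_qELS1 q w : Prop :=
  [/\ forall n, (0 < n)%N -> forall z : R,
        Dq q (Dq q (horner (w n))) z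
        = qnum q (2 * n) * qnum q (2 * n).-1 * (w n.-1).[z],
      forall n, Dq q (horner (w n)) 0 = 0
    & exists2 g0 : R, g0 != 0 & w 0%N = g0%:P].

(* Coefficient sequences carry even indices $\gamma_{2n}$, $\xi_{2n}$ in the
   mathematics; here they are indexed by n. *)
Definition gamma_of w (n : nat) : R := (w n).[0].

Definition is_inverse_seq q g xi : Prop :=
  forall n : nat,
    \sum_(j < n.+1)
       g j * xi (n - j)%N / (qfact q (2 * j) * qfact q (2 * (n - j)))
    = (n == 0%N)%:R.

(* The unique solution of [is_inverse_seq], see [inverse_seqP] and
   [inverse_seq_uniq]. *)
Definition inverse_seq q g : nat -> R := get (is_inverse_seq q g).

Definition ltri q g (i j : nat) : R :=
  if (j <= i)%N then qbin q (2 * i) (2 * j) * g (i - j)%N else 0.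

Definition Fq q w : nat -> nat -> R := ltri q (gamma_of w).
Definition Gq q w : nat -> nat -> R := ltri q (inverse_seq q (gamma_of w)).

(* Products of infinite lower triangular matrices: row i of A vanishes beyond
   column i, so the sums stop there. *)
Definition imul (A B : nat -> nat -> R) (i k : nat) : R :=
  \sum_(j < i.+1) A i j * B j k.

Definition iapp (A : nat -> nat -> R) w (i : nat) : {poly R} :=
  \sum_(j < i.+1) A i j *: w j.

Definition leading (A : nat -> nat -> R) (n : nat) : 'M[R]_n.+1 :=
  \matrix_(i < n.+1, j < n.+1) A i j.

Definition colvec w (n : nat) : 'cV[{poly R}]_n.+1 := \col_(i < n.+1) w i.

Definition conjugate_qELS1 q w what : Prop :=
  forall n : nat,
    what n = \sum_(k < n.+1)
      (qbin q (2 * n) (2 * k) * inverse_seq q (gamma_of w) (n - k)%N)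
        *: 'X^(2 * k).

Lemma qfact_neq0 q (m : nat) : 0 < q < 1 -> qfact q m != 0.
Proof.
move=> /andP[q0 q1]; rewrite /qfact prodf_seq_neq0; apply/allP => j.
rewrite mem_index_iota => /andP[j0 _]; apply/implyP => _.
rewrite mulf_neq0 ?invr_eq0 // subr_eq0 eq_sym lt_eqF //.
by rewrite exprn_ilt1 ?(ltW q0) // -lt0n.
Qed.

Lemma inverse_seqP q g : 0 < q < 1 -> g 0%N != 0 ->
  is_inverse_seq q g (inverse_seq q g).
Proof.
move=> hq g0; apply: (@getPex _ (is_inverse_seq q g)).
pose a j := g j / qfact q (2 * j).
have a0 : a 0%N != 0 by rewrite mulf_neq0 // invr_eq0 qfact_neq0.
pose next (s : seq R) := ((size s == 0%N)%:R -
  \sum_(j < size s) a j.+1 * s`_(size s - j.+1)) / a 0%N.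
pose L n := iter n (fun s => rcons s (next s)) [::].
have sL n : size (L n) = n by elim: n => //= n IH; rewrite size_rcons IH.
pose b n := (L n.+1)`_n.
have bE m n : (n < m)%N -> (L m)`_n = b n.
  elim: m => // m IH; rewrite ltnS leq_eqVlt => /orP[/eqP -> //|lt].
  by rewrite /= nth_rcons sL lt IH.
exists (fun n => b n * qfact q (2 * n)) => n.
transitivity (\sum_(j < n.+1) a j * b (n - j)%N).
  apply: eq_bigr => j _; rewrite /a.
  have := qfact_neq0 (2 * j) hq; have := qfact_neq0 (2 * (n - j)) hq.
  by move=> h1 h2; field; rewrite h1 h2.
rewrite big_ord_recl subn0 {1}/b /= nth_rcons sL ltnn eqxx /next sL.
rewrite mulrC divfK //.
rewrite [X in _ - X + _](_ : _ = \sum_(i < n) a (lift ord0 i) * b (n - lift ord0 i)%N) ?subrK //.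
apply: eq_bigr => j _; rewrite bE //.
by rewrite ltn_subrL /= (leq_ltn_trans _ (ltn_ord j)).
Qed.

Lemma inverse_seq_uniq q g xi : 0 < q < 1 -> g 0%N != 0 ->
  is_inverse_seq q g xi -> xi = inverse_seq q g.
Proof.
move=> hq g0 hx; have hy := inverse_seqP hq g0.
apply/funext => n; elim/ltn_ind: n => n IH.
have := hx n; rewrite -(hy n) !big_ord_recl subn0.
rewrite [X in _ + X = _](_ : _ = \sum_(i < n) g (bump 0 i)
  * inverse_seq q g (n - bump 0 i)%N
  / (qfact q (2 * bump 0 i) * qfact q (2 * (n - bump 0 i)))).
  move=> /addIr; move/mulIf; rewrite invr_eq0 mulf_neq0 ?qfact_neq0 //.
  by move=> /(_ isT) /(mulfI g0).
apply: eq_bigr => j _; rewrite IH //= ltn_subrL /=.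
by rewrite (leq_ltn_trans _ (ltn_ord j)).
Qed.

End qLidstone.

(* Main.v *)
Require Import Defs.
From mathcomp Require Import all_boot all_order all_algebra.
From mathcomp Require Import all_classical all_reals all_analysis.
From mathcomp Require Import ring.
Import Order.TTheory GRing.Theory Num.Theory.
Local Open Scope ring_scope.

(** Let [e = (1, z^2, z^4, ...)]. Comparing coefficients in the [q]-difference
    recurrence gives [w = F e], while conjugacy means by definition
    [what = G e]. The relation between [gamma] and [xi] says exactly that [F]
    and [G] are mutually inverse, so [F^2 (G e) = F e] and [G^2 (F e) = G e].
    Leading principal submatrices inherit these identities because all
    matrices are lower triangular. *)

Section InfiniteMatrices.
Local Set Implicit Arguments.
Local Unset Strict Implicit.
Variable R : realType.
Implicit Types (A B : nat -> nat -> R) (v : nat -> {poly R}).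

Definition lower_triangular A := forall i j, (i < j)%N -> A i j = 0.

Lemma sum_ord_trunc (V : nmodType) (n i : nat) (F : nat -> V) :
  (i < n)%N -> (forall j, (i < j)%N -> F j = 0) ->
  \sum_(j < n) F j = \sum_(j < i.+1) F j.
Proof.
move=> lein F0; rewrite -!(big_mkord xpredT) (big_cat_nat (n := i.+1)) //=.
rewrite [X in _ + X = _]big_nat_cond [X in _ + X = _]big1 ?addr0 // => j.
by rewrite andbT => /andP[/F0].
Qed.

(** Both sides sum [A i j * B j k *: v k] over [j, k <= i]. On the right the inner sum stops at
    [k = j], and the terms with [k > j] vanish because [B] is lower triangular. *)
Lemma iapp_imul A B v : lower_triangular B ->
  iapp (imul A B) v = iapp A (iapp B v).
Proof.
move=> ltB; apply/funext => i; rewrite /iapp /imul.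
under eq_bigr do rewrite scaler_suml.
rewrite exchange_big; apply: eq_bigr => j _ /=.
rewrite -(sum_ord_trunc (n := i.+1) (i := j)
  (F := fun k => B j k *: v k)) ?ltn_ord // => [|k /ltB ->]; last first.
  by rewrite scale0r.
by rewrite scaler_sumr; apply: eq_bigr => k _; rewrite scalerA.
Qed.

Lemma iapp_delta v : iapp (fun i j => (i == j)%:R) v = v.
Proof.
apply/funext => i; rewrite /iapp big_ord_recr /= eqxx scale1r big1 ?add0r //.
by move=> j _; rewrite gtn_eqF ?scale0r.
Qed.

(** Row [i] of the infinite products stops at [i], that of the finite ones at [n]; all terms in
    between are 0. *)
Lemma colvec_iapp_sqr A v n : lower_triangular A ->
  colvec (iapp (imul A A) v) n
    = map_mx polyC (leading A n ^+ 2) *m colvec v n.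
Proof.
move=> ltA; apply/matrixP => i j; rewrite !mxE /iapp.
rewrite -(sum_ord_trunc (n := n.+1) (i := i)
  (F := fun k => imul A A i k *: v k)) ?ltn_ord // => [|k ltik]; last first.
  rewrite /imul big1 ?scale0r // => l _.
  by rewrite (ltA l) ?mulr0 // (leq_trans _ ltik).
apply: eq_bigr => k _; rewrite !mxE mul_polyC; congr (_ *: _).
rewrite /imul -(sum_ord_trunc (n := n.+1) (i := i)
  (F := fun l => A i l * A l k)) ?ltn_ord // => [|l /ltA ->]; last first.
  by rewrite mul0r.
by apply: eq_bigr => l _; rewrite !mxE.
Qed.

End InfiniteMatrices.

Section QBinomialMatrices.
Local Set Implicit Arguments.
Local Unset Strict Implicit.
Variables (R : realType) (q : R).
Hypothesis hq : 0 < q < 1.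
Implicit Types g xi : nat -> R.

Lemma qnum_neq0 m : qnum q m.+1 != 0.
Proof.
case/andP: hq => q0 q1; rewrite mulf_neq0 ?invr_eq0 // subr_eq0 eq_sym lt_eqF //.
by rewrite exprn_ilt1 ?ltW.
Qed.

Lemma qfactS m : qfact q m.+1 = qfact q m * qnum q m.+1.
Proof. by rewrite /qfact big_nat_recr. Qed.

Lemma ltri_lower_triangular g : lower_triangular (ltri q g).
Proof. by move=> i j ltij; rewrite /ltri leqNgt ltij. Qed.

(** For [k <= n] both sides equal $[2n+2]_q!\,g_{n-k}/([2k]_q!\,[2(n-k)]_q!)$. This is the
    recurrence for $D_q^2$ read off at $z^{2k}$. *)
Lemma ltriSS g n k :
  qnum q (2 * k).+1 * qnum q (2 * k).+2 * ltri q g n.+1 k.+1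
    = qnum q (2 * n).+2 * qnum q (2 * n).+1 * ltri q g n k.
Proof.
rewrite /ltri ltnS; case: leqP => // _; last by rewrite !mulr0.
rewrite /qbin subSS !mulnS !add2n !subSS !qfactS.
have := qfact_neq0 (2 * k) hq; have := qfact_neq0 (2 * n - 2 * k) hq.
have := qnum_neq0 (2 * k); have := qnum_neq0 (2 * k).+1.
by move=> h1 h2 h3 h4; field; rewrite h1 h2 h3 h4.
Qed.

Lemma inverse_seq_sym g xi : is_inverse_seq q g xi -> is_inverse_seq q xi g.
Proof.
move=> ginv n; rewrite -ginv (reindex_inj rev_ord_inj); apply: eq_bigr => j _.
rewrite /= subSS subKn; last by rewrite -ltnS.
by rewrite [xi _ * _]mulrC [qfact _ _ * qfact _ (2 * j)]mulrC.
Qed.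

(** In entry [(m + k, k)] the factors $[2(j+k)]_q!$ of the two $q$-binomials cancel. What remains is
    $[2(m+k)]_q!/[2k]_q!$ times the convolution of [xi] and [g] at [m], which is 0 unless
    [m = 0]. *)
Lemma imul_ltri_inverse g xi : is_inverse_seq q g xi ->
  imul (ltri q g) (ltri q xi) = (fun i j => (i == j)%:R).
Proof.
(* After the shift by [k] below, the summand contains [g (m - j) * xi j], so the relation is needed
   with the two sequences swapped. *)
move=> /inverse_seq_sym ginv; apply/funext => i; apply/funext => k.
rewrite /imul; have [ltik|leki] := ltnP i k.
  rewrite big1 ?ltn_eqF // => j _.
  by rewrite [ltri _ xi _ _]ltri_lower_triangular ?mulr0 // (leq_trans _ ltik).
rewrite -(subnK leki) -addSn; move: (i - k)%N => m.
rewrite -(big_mkord xpredT (fun j => ltri q g (m + k) j * ltri q xi j k)).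
rewrite (big_cat_nat (n := k)) ?leq_addl //= big_nat_cond big1 ?add0r; last first.
  move=> j; rewrite andbT => /andP[_ ltjk].
  by rewrite [ltri _ xi _ _]ltri_lower_triangular ?mulr0.
rewrite -{1}[k]add0n big_addn addnK big_mkord -[k in RHS]add0n eqn_add2r.
transitivity (qfact q (2 * (m + k)) / qfact q (2 * k) * (m == 0%N)%:R).
  rewrite -ginv mulr_sumr; apply: eq_bigr => j _.
  have lejm : (j <= m)%N by rewrite -ltnS.
  rewrite /ltri leq_add2r lejm leq_addl /qbin -!mulnBr addnK subnDr.
  have := qfact_neq0 (2 * k) hq; have := qfact_neq0 (2 * j) hq.
  have := qfact_neq0 (2 * (m - j)) hq; have := qfact_neq0 (2 * (j + k)) hq.
  by move=> h1 h2 h3 h4; field; rewrite h1 h2 h3 h4.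
by case: m => [|m]; rewrite ?mulr0 // mulr1 divff // qfact_neq0.
Qed.

Definition even_monomials (k : nat) : {poly R} := 'X^(2 * k).

(** Beyond degree [2 * n] the right-hand side is also 0, since [ltri] vanishes above the
    diagonal. *)
Lemma coef_iapp_ltri g n m :
  (iapp (ltri q g) even_monomials n)`_m
    = if odd m then 0 else ltri q g n m./2.
Proof.
rewrite coef_sum; under eq_bigr do rewrite coefZ coefXn mul2n.
case: ifPn => [om|em].
  rewrite big1 // => k _; case: eqP => [mE|]; last by rewrite mulr0.
  by rewrite mE odd_double in om.
rewrite -{1}(even_halfK em); under eq_bigr do rewrite (inj_eq double_inj).
case: (ltnP n m./2) => [ltn|len].
  rewrite ltri_lower_triangular // big1 // => k _.
  by rewrite gtn_eqF ?mulr0 // (leq_trans _ ltn).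
rewrite (bigD1 (Ordinal (len : (m./2 < n.+1)%N))) //= eqxx mulr1 big1 ?addr0 //.
by move=> k /negPf; rewrite -val_eqE /= eq_sym => ->; rewrite mulr0.
Qed.

End QBinomialMatrices.

Section QDerivative.
Local Set Implicit Arguments.
Local Unset Strict Implicit.
Variables (R : realType) (q : R).
Hypothesis hq : 0 < q < 1.
Implicit Types p : {poly R}.

Lemma horner_inj : injective (horner : {poly R} -> R -> R).
Proof.
move=> p1 p2 eqp; apply/eqP; rewrite -subr_eq0; apply: contraT => neq0.
(* A nonzero difference would have as many distinct roots 0, 1, 2, ... as its size, exceeding its
   degree. *)
pose s := [seq (i%:R : R) | i <- iota 0 (size (p1 - p2))].
suff : (size s < size (p1 - p2)%R)%N by rewrite size_map size_iota ltnn.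
apply: max_poly_roots => //.
  by apply/allP => x _; rewrite rootE hornerD hornerN eqp subrr.
by rewrite map_inj_uniq ?iota_uniq // => i j /eqP; rewrite eqr_nat => /eqP.
Qed.

(** The Jackson derivative on coefficients. The bound [size p] avoids a predecessor; the extra top
    coefficient is 0. *)
Definition qderiv p : {poly R} := \poly_(i < size p) (qnum q i.+1 * p`_i.+1).

Lemma coef_qderiv p i : (qderiv p)`_i = qnum q i.+1 * p`_i.+1.
Proof.
by rewrite coef_poly; case: ltnP => // lepi; rewrite nth_default ?mulr0 ?leqW.
Qed.

Lemma Dq_horner p : Dq q (horner p) = horner (qderiv p).
Proof.
case/andP: hq => _ q1.
have q1n0 : 1 - q != 0 by rewrite subr_eq0 eq_sym lt_eqF.
apply/funext => z; rewrite /Dq; have [->|z0] := eqVneq.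
  rewrite -derivE !horner_coef0 coef_deriv coef_qderiv.
  by rewrite /qnum expr1 divff // mul1r.
(* Widening by one term leaves exactly [size p] terms once the constant term has cancelled. *)
rewrite !(horner_coef_wide _ (leqnSn (size p))) -sumrB big_ord_recl /=.
rewrite !expr0 subrr add0r horner_poly mulr_suml; apply: eq_bigr => i _.
rewrite /= /bump add1n /qnum exprMn !exprSr.
by field; rewrite z0 q1n0 -opprB oppr_eq0 q1n0.
Qed.

(** The constant coefficient is [gamma_of w n] by definition, the linear one vanishes by
    $D_q\omega_n(0)=0$, and the recurrence determines coefficient [m.+2] of [w n.+1] from
    coefficient [m] of [w n]. *)
Lemma qELS1_expansion (w : nat -> {poly R}) : is_qELS1 q w ->
  w = iapp (Fq q w) (even_monomials R).
Proof.
case=> recw dw0 [g0 _ w0]; apply/funext => n; apply/polyP => m.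
rewrite coef_iapp_ltri.
elim: n m => [|n IH] [|[|m]].
- by rewrite w0 /Fq /ltri /qbin /gamma_of w0 hornerC coefC /qfact /= big_geq //
    mulr1 divff ?oner_neq0 // mul1r.
- by rewrite w0 coefC.
- by rewrite w0 coefC /Fq ltri_lower_triangular // if_same.
- by rewrite /Fq /ltri /qbin /gamma_of /= subn0 horner_coef0 muln0 subn0 /qfact
    (big_geq (n := 1)) // mul1r divff ?mul1r // qfact_neq0.
- have := dw0 n.+1; rewrite Dq_horner horner_coef0 coef_qderiv => /eqP.
  by rewrite mulf_eq0 (negPf (qnum_neq0 hq 0)) => /eqP.
have eq_qd : qderiv (qderiv (w n.+1))
    = (qnum q (2 * n).+2 * qnum q (2 * n).+1) *: w n.
  apply: horner_inj; apply/funext => z.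
  by rewrite hornerZ -!Dq_horner recw // mulnS.
have := congr1 (fun p : {poly R} => p`_m) eq_qd.
rewrite !coef_qderiv coefZ IH mulrA /= negbK => eqm.
apply: (mulfI (mulf_neq0 (qnum_neq0 hq m) (qnum_neq0 hq m.+1))).
rewrite eqm; case: ifPn => [_|em]; first by rewrite !mulr0.
by rewrite /Fq -ltriSS // mul2n even_halfK.
Qed.

End QDerivative.

Theorem proposition3p10 (R : realType) (q : R) (hq : 0 < q < 1)
  (w what : nat -> {poly R}) (hw : is_qELS1 q w) :
  conjugate_qELS1 q w what <->
  [/\ w = iapp (imul (Fq q w) (Fq q w)) what,
      what = iapp (imul (Gq q w) (Gq q w)) w
    & forall n : nat, (0 < n)%N ->
        colvec w n = map_mx polyC (leading (Fq q w) n ^+ 2) *m colvec what n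
        /\ colvec what n = map_mx polyC (leading (Gq q w) n ^+ 2) *m colvec w n].
Proof.
set F := Fq q w; set G := Gq q w.
have ltF : lower_triangular F by exact: ltri_lower_triangular.
have ltG : lower_triangular G by exact: ltri_lower_triangular.
have ginv : is_inverse_seq q (gamma_of w) (inverse_seq q (gamma_of w)).
  case: hw => _ _ [g0 g0n0 w0].
  by apply: inverse_seqP => //; rewrite /gamma_of w0 hornerC.
have FGK v : iapp F (iapp G v) = v.
  by rewrite -iapp_imul // imul_ltri_inverse // iapp_delta.
have GFK v : iapp G (iapp F v) = v.
  by rewrite -iapp_imul // imul_ltri_inverse ?iapp_delta //; apply: inverse_seq_sym.
have wE : w = iapp F (even_monomials R) by exact: qELS1_expansion.
have conjE : conjugate_qELS1 q w what <-> what = iapp G (even_monomials R).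
  have GE n : iapp G (even_monomials R) n = \sum_(k < n.+1)
      (qbin q (2 * n) (2 * k) * inverse_seq q (gamma_of w) (n - k)%N)
        *: 'X^(2 * k).
    by apply: eq_bigr => k _; rewrite /G /Gq /ltri -ltnS ltn_ord.
  by split=> [h|-> n]; [apply/funext => n; rewrite GE h | rewrite GE].
rewrite conjE; split=> [whatE|[_ -> _]]; last first.
  (* With $\omega = Fe$, the identity $\hat\omega = G^2\omega$ becomes $\hat\omega = G(G(Fe)) =
     Ge$. *)
  by rewrite iapp_imul // {1}wE GFK.
have wF : w = iapp (imul F F) what by rewrite iapp_imul // whatE FGK.
have whatG : what = iapp (imul G G) w by rewrite iapp_imul // {1}wE GFK.
split=> // n _; split; first by rewrite {1}wF colvec_iapp_sqr.
by rewrite {1}whatG colvec_iapp_sqr.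
Qed.
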